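(* Let $X_1,X_2,\dotsc$ be independent and identically distributed real random variables on a probability space $(\Omega,\mathcal{F},P)$. Suppose that $E[(X_1)^2]<\infty$ and $V[X_1]>0$. Consider the following property of $\omega\in\Omega$: for every real $t>0$, if there exists $M\in\mathbb{N}^+$ such that for every integer $n\ge M$ and every $k\in\mathbb{N}^+$ with $k\ge n^t$ it holds that $$\left|\frac{1}{k}\sum_{i=1}^k X_i(\omega)-E[X_1]\right|<\frac{1}{n},$$ then $t>2$. The set of $\omega\in\Omega$ with this property is $\mathcal{F}$-measurable, and the property holds almost surely.
   Context: $\mathbb{N}^+$ is the set of positive integers. $(\Omega,\mathcal{F},P)$ is a general probability space (no computability assumption), and $E[X]$, $V[X]$ denote the mean and variance of a real random variable $X$. *)

(* Defs.v *)
From HB Require Import structures.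
From mathcomp Require Import all_boot all_order all_algebra finmap.
From mathcomp Require Import all_classical all_reals all_analysis.

Set Implicit Arguments.
Unset Strict Implicit.
Unset Printing Implicit Defensive.

Import Order.TTheory GRing.Theory Num.Theory.
Import numFieldNormedType.Exports.

Local Open Scope classical_set_scope.
Local Open Scope ring_scope.

Definition independent_RVs d (T : measurableType d) (R : realType)
    (P : probability T R) (X : nat -> {RV P >-> R}) : Prop :=
  forall (J : {fset nat}) (A : nat -> set R),
    (forall i, i \in J -> measurable (A i)) ->
    P (\bigcap_(i in [set` J]) (X i @^-1` A i)) =
    (\prod_(i <- J) P (X i @^-1` A i))%E.

(* The two laws are only compared on Borel sets: the value of a measure on a
   non-measurable set carries no meaning. *)
Definition identically_distributed d (T : measurableType d) (R : realType)
    (P : probability T R) (X : nat -> {RV P >-> R}) : Prop :=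
  forall (i j : nat) (A : set R), measurable A ->
    distribution P (X i) A = distribution P (X j) A.

(* The sequence is indexed from 0, so X i is the (i+1)-st variable and X 0 is
   the first one.  The expectation is extended-real valued, hence the fine. *)
Definition rate_exponent_gt2 d (T : measurableType d) (R : realType)
    (P : probability T R) (X : nat -> {RV P >-> R}) (w : T) : Prop :=
  forall t : R, 0 < t ->
    (exists M : nat, (0 < M)%N /\
      forall n k : nat, (M <= n)%N -> (0 < k)%N -> n%:R `^ t <= k%:R :> R ->
        `| k%:R^-1 * (\sum_(i < k) X i w) - fine 'E_P[X 0%N] | < n%:R^-1) ->
    2 < t.

(* Main.v *)
(* For n >= 1 the hypothesis on t becomes weaker as t grows, so it is enough to
   show that it almost surely fails for t = 2.  Write W for the walk centered at
   the mean.  If it held for t = 2, then |W (n ^ 2)| < n for all large n, so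
   between the times (q ^ j) ^ 2 and (q ^ j.+1) ^ 2 the walk would move by less
   than (q + 1) q ^ j.  These increments are independent, so it remains to bound
   below, uniformly in j, the probability of a larger move.

   No central limit theorem is needed for this.  The characteristic function of
   one step satisfies |phi s| ^ 2 <= 1 - k s ^ 2 near 0, hence for a suitable A
   one has E[cos (A W(n ^ 2) / n)] <= 1/2 for large n; since
   1 - cos (s x) <= s |x|, this bounds E|W(n ^ 2)| from below by a multiple of n,
   and with E[W] = 0 and E[W(n ^ 2) ^ 2] = n ^ 2 Var a Paley-Zygmund argument
   gives P(W(n ^ 2) >= eps n) >= c.  Chaining r consecutive blocks yields
   P(W(r n ^ 2) >= r eps n) >= c ^ r, and for r = q ^ 2 - 1 and q large the
   threshold r eps n exceeds (q + 1) n. *)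
Require Import Defs.
From HB Require Import structures.
From mathcomp Require Import all_boot all_order all_algebra finmap.
From mathcomp Require Import all_classical all_reals all_analysis.
From mathcomp Require Import measurable_realfun ring lra.

Set Implicit Arguments.
Unset Strict Implicit.
Unset Printing Implicit Defensive.

Import Order.TTheory GRing.Theory Num.Theory.
Import numFieldNormedType.Exports.

Local Open Scope classical_set_scope.
Local Open Scope ring_scope.

(** * Independence of two events or two variables, and products of expectations *)

Section independence.
Context (d : measure_display) (T : measurableType d) (R : realType).
Context (P : probability T R).

(** With [A] fixed, both sides are finite measures in [B]: [P] restricted to [A], and [P] scaled by
    [P A]. They agree on the pi-system [H], hence on the sigma-algebra it generates. *)
Lemma indep_g_sigmar (H : set (set T)) (A : set T) :
  measurable A -> H `<=` measurable -> setI_closed H -> H setT ->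
  (forall B, H B -> P (A `&` B) = (P A * P B)%E) ->
  forall B, <<s H >> B -> P (A `&` B) = (P A * P B)%E.
Proof.
move=> mA Hm HI HT AH B HB.
have rP : (0 <= fine (P A))%R by exact: fine_ge0.
transitivity (mscale (NngNum rP) P B); last first.
  by congr (_ * _)%E; exact/fineK/fin_num_measure.
transitivity (mrestr P mA B); first by rewrite /= /mrestr setIC.
apply: (g_sigma_algebra_measure_unique H Hm (fun=> setT)) => //.
- by apply/seteqP; split=> // w _; exists 0%N.
- move=> C HC; transitivity (P A * P C)%E; first by rewrite /= /mrestr setIC AH.
  by congr (_ * _)%E; exact/esym/fineK/fin_num_measure.
- by move=> _; rewrite /= /mrestr (le_lt_trans (probability_le1 _ _)) ?ltry//;
  exact: measurableI.
Qed.

(** The one-sided extension is applied twice: the outer use enlarges [G] with [B] fixed, the inner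
    one enlarges [H] with a member of [G] fixed. *)
Lemma indep_g_sigma (G H : set (set T)) :
  G `<=` measurable -> setI_closed G -> G setT ->
  H `<=` measurable -> setI_closed H -> H setT ->
  (forall A B, G A -> H B -> P (A `&` B) = (P A * P B)%E) ->
  forall A B, <<s G >> A -> <<s H >> B -> P (A `&` B) = (P A * P B)%E.
Proof.
move=> Gm GI GT Hm HI HT GH A B GA HB.
have mB : measurable B by exact: (smallest_sub (@sigma_algebra_measurable _ T)) HB.
rewrite setIC muleC; apply: (indep_g_sigmar mB Gm) => // C GC.
rewrite setIC muleC; apply: (indep_g_sigmar (Gm _ GC) Hm) => // D HD.
exact: GH.
Qed.

Definition indep2 (U V : T -> R) := forall A B, measurable A -> measurable B ->
  P (U @^-1` A `&` V @^-1` B) = (P (U @^-1` A) * P (V @^-1` B))%E.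

Lemma indep2_comp {U V : T -> R} {f g : R -> R} : measurable_fun setT f ->
  measurable_fun setT g -> indep2 U V -> indep2 (f \o U) (g \o V).
Proof.
move=> mf mg UV A B mA mB; apply: (UV (f @^-1` A) (g @^-1` B)).
- by rewrite -[_ @^-1` _]setTI; exact: mf.
- by rewrite -[_ @^-1` _]setTI; exact: mg.
Qed.

(** Independence says that the joint law and the product law agree on rectangles, and this
    determines the product measure. *)
Lemma indep2_law (U V : {RV P >-> R}) : indep2 U V ->
  forall X, measurable X ->
  (distribution P U \x distribution P V)%E X =
  pushforward P (fun w => (U w, V w)) X.
Proof.
move=> UV X mX.
have mUV : measurable_fun setT (fun w => (U w, V w)).
  by apply/measurable_fun_pairP; split; exact: measurable_funP.
pose W : {RV P >-> (R * R)%type} := mfun_Sub (mem_set mUV).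
apply: (@product_measure_unique _ _ _ _ R (distribution P U) (distribution P V)
  (distribution P W)) => // A B mA mB.
Qed.

Local Notation law U V := (distribution P U \x distribution P V)%E.

Lemma integral_indep2_law (U V : {RV P >-> R}) (W : {RV P >-> (R * R)%type})
    (h : R * R -> \bar R) : indep2 U V -> W = (fun w => (U w, V w)) :> (T -> R * R) ->
  (\int[law U V]_z h z = \int[distribution P W]_z h z)%E.
Proof.
move=> UV WE; apply: eq_measure_integral => A mA _.
by have := indep2_law UV mA; rewrite -WE.
Qed.

(** By Tonelli, the integral of [|x| |y|] under the product law splits into two finite first
    absolute moments. *)
Lemma integrable_law_prod (U V : {RV P >-> R}) :
  P.-integrable setT (EFin \o U) -> P.-integrable setT (EFin \o V) ->
  (law U V).-integrable setT (fun z => (z.1 * z.2)%:E).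
Proof.
move=> /integrableP[_ iU] /integrableP[_ iV].
have mm : measurable_fun setT (EFin \o (fun z : R * R => z.1 * z.2)).
  by apply/measurable_EFinP; exact: measurable_funM.
have mn : measurable_fun setT (fun x : R => `|x|%:E).
  by apply/measurable_EFinP; exact: normr_measurable.
apply/integrable12ltyP => //=.
under eq_integral => x _.
  under eq_integral => y _ do rewrite normrM EFinM.
rewrite ge0_integralZl//.
  over.
rewrite ge0_integralZr//; last exact: integral_ge0.
rewrite !ge0_integral_distribution//.
have U0 : (0 <= \int[P]_x ((fun y => `|y|%:E) \o U) x)%E.
  by apply: integral_ge0 => w _; rewrite lee_fin.
by rewrite lte_mul_pinfty ?ge0_fin_numE.
Qed.

Lemma indep2_integrable (U V : {RV P >-> R}) : indep2 U V ->
  P.-integrable setT (EFin \o U) -> P.-integrable setT (EFin \o V) ->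
  P.-integrable setT (EFin \o (fun w => U w * V w)).
Proof.
move=> UV iU iV; apply/integrableP; split.
  by apply/measurable_EFinP; exact: measurable_funM.
have mUV : measurable_fun setT (fun w => (U w, V w)).
  by apply/measurable_fun_pairP; split; exact: measurable_funP.
pose W : {RV P >-> (R * R)%type} := mfun_Sub (mem_set mUV).
have /integrableP[mm] := integrable_law_prod iU iV.
rewrite (integral_indep2_law (W := W) _ UV)//= ge0_integral_distribution//=.
apply/measurable_EFinP; apply: (measurableT_comp (@normr_measurable R setT)).
exact: measurable_funM.
Qed.

(** Transfer to the joint law, replace it by the product law, and apply Fubini. *)
Lemma indep2_Rintegral (U V : {RV P >-> R}) : indep2 U V ->
  P.-integrable setT (EFin \o U) -> P.-integrable setT (EFin \o V) ->
  \int[P]_w (U w * V w) = \int[P]_w U w * \int[P]_w V w.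
Proof.
move=> UV iU iV; have iL := integrable_law_prod iU iV.
have mm := measurable_int _ iL.
have mUV : measurable_fun setT (fun w => (U w, V w)).
  by apply/measurable_fun_pairP; split; exact: measurable_funP.
pose W : {RV P >-> (R * R)%type} := mfun_Sub (mem_set mUV).
have iUV := indep2_integrable UV iU iV.
have dU : (distribution P U).-integrable setT EFin.
  exact: (@integrable_pushforward _ _ _ _ _ U).
have dV : (distribution P V).-integrable setT EFin.
  exact: (@integrable_pushforward _ _ _ _ _ V).
rewrite /Rintegral -fineM; try exact: integrable_fin_num.
congr fine; transitivity (\int[distribution P W]_z (z.1 * z.2)%:E)%E.
  by rewrite integral_distribution.
rewrite -(integral_indep2_law (W := W) _ UV)//= -(integral12_prod_meas1 iL)/=.
rewrite /fubini_F/=.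
under eq_integral => x _.
  under eq_integral => y _ do rewrite EFinM.
  rewrite integralZl//.
  over.
have finV := integrable_fin_num measurableT dV.
rewrite -(fineK finV) integralZr//.
by rewrite fineK// !integral_distribution.
Qed.

Lemma indep2_RintegralM (U V : T -> R) : measurable_fun setT U ->
  measurable_fun setT V -> indep2 U V ->
  P.-integrable setT (EFin \o U) -> P.-integrable setT (EFin \o V) ->
  P.-integrable setT (EFin \o (fun w => U w * V w)) /\
  \int[P]_w (U w * V w) = \int[P]_w U w * \int[P]_w V w.
Proof.
move=> mU mV UV iU iV.
pose U' : {RV P >-> R} := mfun_Sub (mem_set mU).
pose V' : {RV P >-> R} := mfun_Sub (mem_set mV).
split; first exact: (@indep2_integrable U' V').
exact: (@indep2_Rintegral U' V').
Qed.
End independence.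

(** * Sigma-algebras generated by disjoint groups of variables *)

Section cylinders.
Context (d : measure_display) (T : measurableType d) (R : realType).
Context (P : probability T R) (X : nat -> {RV P >-> R}).

(* [A] is trivial outside a finite subset of [I], so the countable intersection
   is in fact finite; this makes intersections of cylinders immediate. *)
Definition cylinder (I : set nat) : set (set T) :=
  [set C | exists (n : nat) (A : nat -> set R), [/\ forall i, measurable (A i),
    forall i, ~ (I i /\ (i < n)%N) -> A i = setT &
    C = \bigcap_i (X i @^-1` A i)]].

Lemma measurable_preimage_RV (i : nat) (A : set R) :
  measurable A -> measurable (X i @^-1` A).
Proof. by move=> mA; rewrite -[_ @^-1` _]setTI; exact: measurable_funP. Qed.

Lemma cylinder_measurable I : cylinder I `<=` measurable.
Proof.
move=> _ [n [A [mA _ ->]]]; apply: bigcapT_measurable => i.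
exact: measurable_preimage_RV.
Qed.

Lemma cylinder_setI I : setI_closed (cylinder I).
Proof.
move=> _ _ [n [A [mA AI ->]]] [m [B [mB BI ->]]].
exists (maxn n m), (fun i => A i `&` B i); split.
- by move=> i; exact: measurableI.
- move=> i Ii; rewrite AI ?BI ?setIT// => -[? im]; apply: Ii; split=> //;
    by rewrite leq_max im ?orbT.
- by rewrite -bigcapI; apply: eq_bigcapr => i _; rewrite preimage_setI.
Qed.

Lemma cylinderT I : cylinder I setT.
Proof. by exists 0%N, (fun=> setT); split => //; rewrite bigcapT. Qed.

Lemma cylinder1 (I : set nat) i A : I i -> measurable A ->
  cylinder I (X i @^-1` A).
Proof.
move=> Ii mA; exists i.+1, (fun j => if j == i then A else setT); split.
- by move=> j; case: ifP.
- by move=> j; case: eqP => // -> []; split.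
- apply/seteqP; split => [w Aw j _|w /(_ i Logic.I)]; last by rewrite eqxx.
  by case: eqP => // ->.
Qed.

Hypothesis Xindep : independent_RVs X.

Lemma prob_cylinder (n : nat) (A : nat -> set R) :
  (forall i, measurable (A i)) -> (forall i, (n <= i)%N -> A i = setT) ->
  P (\bigcap_i (X i @^-1` A i)) = (\prod_(i < n) P (X i @^-1` A i))%E.
Proof.
move=> mA AT.
rewrite -(big_mkord xpredT (fun i => P (X i @^-1` A i))) /index_iota subn0.
(* [Xindep] speaks of finite sets, so the product over [i < n] is rewritten as one over the finite
   set of elements of [iota 0 n]. *)
rewrite -[iota 0 n]undup_id ?iota_uniq//.
rewrite -(perm_big _ (seq_fset_perm tt (iota 0 n))) -Xindep//.
congr (P _); apply/seteqP; split => [w Aw i _|w Aw i _]; first exact: Aw.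
have [ni|ni] := leqP n i; first by rewrite AT.
apply: Aw; suff : i \in seq_fset tt (iota 0 n) by [].
by rewrite seq_fsetE mem_iota.
Qed.

(** Over a common range of indices, at most one of [A i] and [B i] differs from [setT] at each [i],
    so the product formula splits factor by factor. *)
Lemma cylinder_indep (I J : set nat) : I `&` J = set0 ->
  forall A B, cylinder I A -> cylinder J B -> P (A `&` B) = (P A * P B)%E.
Proof.
move=> IJ _ _ [n [A [mA AI ->]]] [m [B [mB BJ ->]]].
rewrite -bigcapI (@prob_cylinder (maxn n m) A)//; last first.
  by move=> i; rewrite geq_max => /andP[ni mi]; rewrite AI// ltnNge ni => -[].
rewrite (@prob_cylinder (maxn n m) B)//; last first.
  by move=> i; rewrite geq_max => /andP[ni mi]; rewrite BJ// ltnNge mi => -[].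
rewrite -big_split/=.
under eq_bigcapr do rewrite -preimage_setI.
rewrite (@prob_cylinder (maxn n m) (fun i => A i `&` B i)); last 2 first.
- by move=> i; exact: measurableI.
- move=> i; rewrite geq_max => /andP[ni mi].
  by rewrite AI ?BJ ?setIT// ltnNge ?ni ?mi => -[].
apply: eq_bigr => i _.
have [Ii|Ii] := pselect (I i).
- rewrite BJ; first by rewrite setIT preimage_setT probability_setT mule1.
  by move=> [Ji _]; have : (I `&` J) i by []; rewrite IJ.
- rewrite AI; first by rewrite setTI preimage_setT probability_setT mul1e.
  by case.
Qed.

Lemma sigma_indep (I J : set nat) : I `&` J = set0 ->
  forall A B, <<s cylinder I >> A -> <<s cylinder J >> B ->
  P (A `&` B) = (P A * P B)%E.
Proof.
move=> IJ A B; apply: indep_g_sigma; try exact: cylinder_measurable;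
  try exact: cylinder_setI; try exact: cylinderT.
exact: cylinder_indep.
Qed.

Lemma sigma_cylinder_measurable (I : set nat) A :
  <<s cylinder I >> A -> measurable A.
Proof.
apply: (smallest_sub (@sigma_algebra_measurable _ T)).
exact: cylinder_measurable.
Qed.

Lemma sigma_sum (I : set nat) (c : R) (a m : nat) (A : set R) :
  (forall i, (i < m)%N -> I (a + i)%N) -> measurable A ->
  <<s cylinder I >> ((fun w => \sum_(i < m) (X (a + i)%N w - c)) @^-1` A).
Proof.
move=> aI mA.
(* Equipping [T] with the generated sigma-algebra turns the claim into measurability of a finite
   sum. *)
have mf : measurable_fun (setT : set (g_sigma_algebraType (cylinder I)))
    (fun w => \sum_(i < m) (X (a + i)%N w - c) : R).
  apply: measurable_sum => i; apply: measurable_funB => //.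
  move=> _ B mB; rewrite setTI; apply: sub_sigma_algebra.
  by apply: cylinder1 => //; exact: aI.
by rewrite -[_ @^-1` _]setTI; exact: mf.
Qed.
End cylinders.

(** * Elementary inequalities for sine, cosine and powers *)

Section elementary_bounds.
Context (R : realType).
Implicit Type y : R.

Lemma sin_MVT y : 0 <= y -> exists2 c, 0 <= c <= y & sin y = cos c * y.
Proof.
move=> y0.
have [c] := @MVT_segment R sin cos 0 y y0 (fun x _ => is_derive_sin x)
  (continuous_subspaceT (@continuous_sin R)).
by rewrite in_itv/= sin0 !subr0 => cy ->; exists c.
Qed.

Lemma normr_sin_le y : `|sin y| <= `|y|.
Proof.
wlog y0 : y / 0 <= y => [hw|].
  have [/hw//|y0] := leP 0 y.
  by have := hw (- y); rewrite sinN !normrN; apply; rewrite oppr_ge0 ltW.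
have [c _ ->] := sin_MVT y0.
by rewrite normrM ler_piMl// cos_max.
Qed.

Lemma oneBcosE y : 1 - cos y = 2 * sin (y / 2) ^+ 2.
Proof.
have {1}-> : y = (y / 2) *+ 2 by rewrite mulr2n; lra.
by rewrite cos_mulr2n sin2cos2 mulr2n; ring.
Qed.

Lemma oneBcos_ge0 y : 0 <= 1 - cos y.
Proof. by rewrite subr_ge0 cos_le1. Qed.

Lemma oneBcos_le y : 1 - cos y <= `|y|.
Proof.
have h := normr_sin_le (y / 2); have h1 := sin_max (y / 2).
rewrite oneBcosE -real_normK ?num_real// expr2.
have -> : `|y| = 2 * (1 * `|y / 2|) by rewrite normrM (@ger0_norm R 2^-1); lra.
by rewrite ler_pM2l// ler_pM.
Qed.

(** By the mean value theorem the difference is [(1 - cos c) * y] up to sign, with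
    [1 - cos c <= c <= y]. The quadratic order is what makes the squared sine part of a
    characteristic function of order [s ^ 4]. *)
Lemma normr_sinB_le y : `|sin y - y| <= y ^+ 2.
Proof.
wlog y0 : y / 0 <= y => [hw|].
  have [/hw//|y0] := leP 0 y.
  have := hw (- y); rewrite sinN -opprD normrN sqrrN; apply.
  by rewrite oppr_ge0 ltW.
have [c /andP[c0 cy] ->] := sin_MVT y0.
have -> : cos c * y - y = - ((1 - cos c) * y) by ring.
rewrite normrN normrM (ger0_norm y0) ger0_norm ?oneBcos_ge0// expr2.
by rewrite ler_wpM2r// (le_trans (oneBcos_le c))// ger0_norm.
Qed.

(** Here [|sin (y / 2)| >= |y| / 2 - y ^ 2 / 4 >= |y| / 4], to be inserted in the half-angle
    formula. *)
Lemma oneBcos_ge y : `|y| <= 1 -> y ^+ 2 / 8 <= 1 - cos y.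
Proof.
move=> y1; rewrite oneBcosE.
have := normr_sinB_le (y / 2); set s := sin _ => hs.
have {}hs : `|y| / 4 <= `|s|.
  have : `|y / 2| <= `|s| + (y / 2) ^+ 2.
    have {1}-> : y / 2 = s - (s - y / 2) by ring.
    by rewrite (le_trans (ler_normB _ _))// lerD2l.
  have -> : `|y / 2| = `|y| / 2 by rewrite normrM (@ger0_norm R 2^-1); lra.
  have -> : (y / 2) ^+ 2 = `|y| ^+ 2 / 4 by rewrite real_normK ?num_real//; field.
  have := normr_ge0 y; nra.
rewrite -(real_normK (num_real y)) -(real_normK (num_real s)).
have := normr_ge0 y; nra.
Qed.

(** A Bernoulli-type substitute for exponential decay: it drives powers of the characteristic
    function below [1/4], and later the probability [(1 - c) ^ J] to 0. *)
Lemma expr_oneB_le (x : R) (m : nat) : 0 <= x <= 1 ->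
  (1 - x) ^+ m * (1 + m%:R * x) <= 1.
Proof.
move=> /andP[x0 x1]; elim: m => [|m IH].
  by rewrite expr0 mul0r addr0 mulr1.
apply: le_trans IH; rewrite exprSr -mulrA ler_wpM2l ?exprn_ge0 ?subr_ge0//.
by have := ler0n R m; rewrite -natr1; nra.
Qed.
End elementary_bounds.

(** * Integrability of real-valued functions under a probability *)

Section integrable_real.
Context (d : measure_display) (T : measurableType d) (R : realType).
Context (P : probability T R).
Implicit Types f g : T -> R.

Lemma integrable_realD f g : P.-integrable setT (EFin \o f) ->
  P.-integrable setT (EFin \o g) ->
  P.-integrable setT (EFin \o (fun w => f w + g w)).
Proof. by move=> fi gi; have := integrableD measurableT fi gi. Qed.

Lemma integrable_realB f g : P.-integrable setT (EFin \o f) ->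
  P.-integrable setT (EFin \o g) ->
  P.-integrable setT (EFin \o (fun w => f w - g w)).
Proof. by move=> fi gi; have := integrableB measurableT fi gi. Qed.

Lemma integrable_realZ (k : R) f : P.-integrable setT (EFin \o f) ->
  P.-integrable setT (EFin \o (fun w => k * f w)).
Proof. by move=> fi; have := integrableZl measurableT k fi. Qed.

Lemma integrable_real_cst (k : R) : P.-integrable setT (EFin \o (fun _ : T => k)).
Proof. exact: finite_measure_integrable_cst. Qed.

Lemma Rintegral_prob_cst (k : R) : \int[P]_w k = k.
Proof.
rewrite Rintegral_cst// -[RHS]mulr1; congr (_ * _).
by rewrite -[RHS]/(fine 1%E); congr fine; exact: probability_setT.
Qed.

Lemma integrable_real_le f g : measurable_fun setT f ->
  (forall w, `|f w| <= g w) -> P.-integrable setT (EFin \o g) ->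
  P.-integrable setT (EFin \o f).
Proof.
move=> mf fg; apply: le_integrable => //; first exact/measurable_EFinP.
by move=> w _ /=; rewrite lee_fin (le_trans (fg w))// ler_norm.
Qed.

Lemma integrable_real_bounded f (k : R) : measurable_fun setT f ->
  (forall w, `|f w| <= k) -> P.-integrable setT (EFin \o f).
Proof. move=> mf fk; exact: (@integrable_real_le f (fun=> k) mf fk (integrable_real_cst k)). Qed.

Lemma Rintegral_indic (A : set T) : measurable A ->
  \int[P]_w (\1_A w) = fine (P A).
Proof. by move=> mA; rewrite /Rintegral integral_indic// setIT. Qed.
End integrable_real.

(** * Transfer of expectations between identically distributed variables *)

Section identically_distributed.
Context (d : measure_display) (T : measurableType d) (R : realType).
Context (P : probability T R) (X : nat -> {RV P >-> R}).
Hypothesis Xid : identically_distributed X.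

Lemma id_integral (i j : nat) (g : R -> R) : measurable_fun setT g ->
  P.-integrable setT (EFin \o (fun w => g (X i w))) ->
  P.-integrable setT (EFin \o (fun w => g (X j w))) /\
  \int[P]_w g (X i w) = \int[P]_w g (X j w).
Proof.
move=> mg ig.
have mEg : measurable_fun setT (EFin \o g) by exact/measurable_EFinP.
have dE h : (\int[distribution P (X i)]_x h x = \int[distribution P (X j)]_x h x)%E.
  by apply: eq_measure_integral => A mA _; exact: Xid.
have ig' : P.-integrable setT (EFin \o (fun w => g (X j w))).
  apply/integrableP; split.
    by apply/measurable_EFinP; exact: measurableT_comp.
  have mEg' : measurable_fun setT (fun x => `|(g x)%:E|%E).
    exact: measurableT_comp.
  case/integrableP : ig => _.
  rewrite -(@ge0_integral_distribution _ _ _ _ _ P (X i) (fun x => `|(g x)%:E|%E))//.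
  by rewrite dE ge0_integral_distribution.
split=> //; congr fine.
rewrite -(@integral_distribution _ _ _ _ _ P (X i) (EFin \o g))//.
by rewrite dE integral_distribution.
Qed.
End identically_distributed.

(** * First and second moments of the first variable *)

Section moments.
Context (d : measure_display) (T : measurableType d) (R : realType).
Context (P : probability T R) (X : nat -> {RV P >-> R}).
Hypothesis X2fin : ('E_P[(fun w => X 0%N w ^+ 2)%R] < +oo)%E.

Lemma integrable_X0sq : P.-integrable setT (EFin \o (fun w => X 0%N w ^+ 2)).
Proof.
apply/integrableP; split.
  by apply/measurable_EFinP; exact: measurable_funX.
move: X2fin; rewrite unlock; apply: le_lt_trans.
apply: ge0_le_integral => //=.
- by apply/measurable_EFinP; apply: measurableT_comp => //; exact: measurable_funX.
- by apply/measurable_EFinP; exact: measurable_funX.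
- by move=> w _; rewrite ger0_norm// sqr_ge0.
Qed.

Lemma integrable_X0 : P.-integrable setT (EFin \o X 0%N).
Proof.
apply: (@integrable_real_le _ _ _ _ _ (fun w => 1 + X 0%N w ^+ 2)) => //.
  move=> w; move: (X 0%N w) => x; rewrite -(real_normK (num_real x)).
  by have := normr_ge0 x; nra.
apply: integrable_realD; first exact: integrable_real_cst.
exact: integrable_X0sq.
Qed.
End moments.

(** * The centered walk, its mean and its variance *)

Section centered_walk.
Context (d : measure_display) (T : measurableType d) (R : realType).
Context (P : probability T R) (X : nat -> {RV P >-> R}).

Definition mean : R := fine 'E_P[X 0%N].

(** The starting index [a] is a parameter so that increments of the walk are again walks. *)
Definition walk (a m : nat) (w : T) : R := \sum_(i < m) (X (a + i)%N w - mean).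

Definition var : R := \int[P]_w ((X 0%N w - mean) ^+ 2).

Lemma walk0 a w : walk a 0 w = 0.
Proof. by rewrite /walk big_ord0. Qed.

Lemma walkS a m w : walk a m.+1 w = walk a m w + (X (a + m)%N w - mean).
Proof. by rewrite /walk big_ord_recr. Qed.

Lemma walkD a m n w : walk a (m + n) w = walk a m w + walk (a + m) n w.
Proof.
elim: n => [|n IH]; first by rewrite addn0 walk0 addr0.
by rewrite addnS !walkS IH -addrA addnA.
Qed.

Lemma measurable_centered i : measurable_fun setT (fun w => X i w - mean).
Proof. exact: measurable_funB. Qed.

Lemma measurable_walk a m : measurable_fun setT (walk a m).
Proof. by rewrite /walk; apply: measurable_sum => i; exact: measurable_centered. Qed.

Hypothesis Xindep : independent_RVs X.

Lemma walk_indep a m : indep2 P (walk a m) (fun w => X (a + m)%N w - mean).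
Proof.
move=> A B mA mB.
apply: (@sigma_indep _ _ _ _ _ Xindep [set i | i < a + m]%N [set i | a + m <= i]%N).
- by apply/seteqP; split => // i /= [] /leq_trans h /h; rewrite ltnn.
- by apply: sigma_sum => // i im /=; rewrite ltn_add2l.
(* The next step is treated as a sum of length 1. *)
- have := @sigma_sum _ _ _ _ X [set i | a + m <= i]%N mean (a + m) 1 B.
  rewrite [X in X @^-1` _](_ : _ = fun w => X (a + m)%N w - mean); last first.
    by apply/funext => w; rewrite big_ord1 addn0.
  by apply => // i _ /=; rewrite leq_addr.
Qed.

Hypothesis Xid : identically_distributed X.
Hypothesis X2fin : ('E_P[(fun w => X 0%N w ^+ 2)%R] < +oo)%E.
Hypothesis Vpos : (0 < 'V_P[X 0%N])%E.

Lemma integrable_X0B : P.-integrable setT (EFin \o (fun w => X 0%N w - mean)).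
Proof.
apply: integrable_realB; last exact: integrable_real_cst.
exact: integrable_X0.
Qed.

Lemma integrable_X0B2 :
  P.-integrable setT (EFin \o (fun w => (X 0%N w - mean) ^+ 2)).
Proof.
apply: (@integrable_real_le _ _ _ _ _ (fun w => 2 * X 0%N w ^+ 2 + 2 * mean ^+ 2)).
- exact/measurable_funX/measurable_centered.
- move=> w; rewrite ger0_norm ?sqr_ge0//; move: (X 0%N w) => x.
  by have := sqr_ge0 (x + mean); nra.
- apply: integrable_realD; last exact: integrable_real_cst.
  by apply: integrable_realZ; exact: integrable_X0sq.
Qed.

Lemma X0B_mean0 : \int[P]_w (X 0%N w - mean) = 0.
Proof.
rewrite RintegralB//; last 2 first.
- exact: integrable_X0.
- exact: integrable_real_cst.
by rewrite Rintegral_prob_cst /mean unlock subrr.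
Qed.

Lemma var_gt0 : 0 < var.
Proof.
have VE : (\int[P]_w ((X 0%N w - mean) ^+ 2)%:E = 'V_P[X 0%N])%E.
  by rewrite /variance /mean covariance.unlock !expectation.unlock; apply: eq_integral => w _; rewrite expr2.
have := integrable_fin_num measurableT integrable_X0B2.
rewrite /= VE => fv; rewrite /var /Rintegral VE.
by apply: fine_gt0; rewrite Vpos/= -ge0_fin_numE ?ltW.
Qed.

Lemma centered_mean0 i : P.-integrable setT (EFin \o (fun w => X i w - mean)) /\
  \int[P]_w (X i w - mean) = 0.
Proof.
have [] := @id_integral _ _ _ _ _ Xid 0%N i (fun x => x - mean) _ integrable_X0B.
  exact: measurable_funB.
by rewrite X0B_mean0.
Qed.

Lemma centered_var i :
  P.-integrable setT (EFin \o (fun w => (X i w - mean) ^+ 2)) /\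
  \int[P]_w ((X i w - mean) ^+ 2) = var.
Proof.
have [] := @id_integral _ _ _ _ _ Xid 0%N i (fun x => (x - mean) ^+ 2) _ integrable_X0B2.
  by apply: measurable_funX; exact: measurable_funB.
by [].
Qed.

Lemma walk_mean0 a m :
  P.-integrable setT (EFin \o walk a m) /\ \int[P]_w (walk a m w) = 0.
Proof.
elim: m => [|m [IHi IHE]].
  have -> : walk a 0 = cst 0 by apply/funext => w; rewrite walk0.
  by split; [exact: integrable_real_cst|exact: Rintegral_prob_cst].
have [Yi YE] := centered_mean0 (a + m).
have -> : walk a m.+1 = (fun w => walk a m w + (X (a + m)%N w - mean)).
  by apply/funext => w; rewrite walkS.
split; first exact: integrable_realD.
by rewrite RintegralD// IHE YE addr0.
Qed.

(** Induction on [m]: the cross term has mean 0, because the next step is independent of the walk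
    and both are centered. *)
Lemma walk_var a m :
  P.-integrable setT (EFin \o (fun w => walk a m w ^+ 2)) /\
  \int[P]_w (walk a m w ^+ 2) = m%:R * var.
Proof.
elim: m => [|m [IHi IHE]].
  have -> : (fun w => walk a 0 w ^+ 2) = cst 0.
    by apply/funext => w; rewrite walk0 expr0n.
  split; first exact: integrable_real_cst.
  by rewrite mul0r -[RHS](Rintegral_prob_cst P); congr Rintegral;
    apply/funext => w; rewrite walk0 expr0n.
have [Yi YE] := centered_mean0 (a + m).
have [Y2i Y2E] := centered_var (a + m).
have [Wi WE] := walk_mean0 a m.
have [WYi WYE] := indep2_RintegralM (measurable_walk a m)
  (measurable_centered (a + m)) (walk_indep a m) Wi Yi.
have E w : walk a m.+1 w ^+ 2 =
    walk a m w ^+ 2 + (X (a + m)%N w - mean) ^+ 2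
      + 2 * (walk a m w * (X (a + m)%N w - mean)) by rewrite walkS; ring.
have {}E : (fun w => walk a m.+1 w ^+ 2) = (fun w =>
    walk a m w ^+ 2 + (X (a + m)%N w - mean) ^+ 2
      + 2 * (walk a m w * (X (a + m)%N w - mean))) by apply/funext.
rewrite E; have i1 := integrable_realD IHi Y2i.
have i2 := integrable_realZ 2 WYi.
split; first exact: integrable_realD.
rewrite RintegralD// RintegralD// RintegralZl// IHE Y2E WYE WE mul0r mulr0.
by rewrite addr0 -natr1 mulrDl mul1r.
Qed.
End centered_walk.

(** * Squared modulus of the characteristic function *)

Section characteristic_function.
Context (d : measure_display) (T : measurableType d) (R : realType).
Context (P : probability T R) (X : nat -> {RV P >-> R}).

Lemma integrable_cos (U : T -> R) (s : R) : measurable_fun setT U ->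
  P.-integrable setT (EFin \o (fun w => cos (s * U w))).
Proof.
move=> mU; apply: (@integrable_real_bounded _ _ _ _ _ 1) => [|w].
  apply: (measurableT_comp (continuous_measurable_fun (@continuous_cos R))).
  exact: measurable_funM.
exact: cos_max.
Qed.

Lemma integrable_sin (U : T -> R) (s : R) : measurable_fun setT U ->
  P.-integrable setT (EFin \o (fun w => sin (s * U w))).
Proof.
move=> mU; apply: (@integrable_real_bounded _ _ _ _ _ 1) => [|w].
  apply: (measurableT_comp (continuous_measurable_fun (@continuous_sin R))).
  exact: measurable_funM.
exact: sin_max.
Qed.

(** This is [|E exp(i s U)| ^ 2], with real and imaginary parts separate so that all integrals stay
    real. *)
Definition sqnorm_charfun (U : T -> R) (s : R) : R :=
  (\int[P]_w cos (s * U w)) ^+ 2 + (\int[P]_w sin (s * U w)) ^+ 2.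

(** The addition formulas and independence reduce this to the multiplicativity of the squared
    modulus of complex numbers. *)
Lemma sqnorm_charfunD (U V : T -> R) (s : R) : measurable_fun setT U ->
  measurable_fun setT V -> indep2 P U V ->
  sqnorm_charfun (fun w => U w + V w) s =
  sqnorm_charfun U s * sqnorm_charfun V s.
Proof.
move=> mU mV UV.
have ms : measurable_fun setT (fun x : R => sin (s * x)).
  by apply: (measurableT_comp (continuous_measurable_fun (@continuous_sin R))); exact: measurable_funM.
have mc : measurable_fun setT (fun x : R => cos (s * x)).
  by apply: (measurableT_comp (continuous_measurable_fun (@continuous_cos R))); exact: measurable_funM.
have key (f g : R -> R) : measurable_fun setT f -> measurable_fun setT g ->
    P.-integrable setT (EFin \o (f \o U)) ->
    P.-integrable setT (EFin \o (g \o V)) ->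
    P.-integrable setT (EFin \o (fun w => f (U w) * g (V w))) /\
    \int[P]_w (f (U w) * g (V w)) = \int[P]_w f (U w) * \int[P]_w g (V w).
  move=> mf mg iU iV.
  apply: (@indep2_RintegralM _ _ _ _ (f \o U) (g \o V)) => //.
  - exact: measurableT_comp.
  - exact: measurableT_comp.
  - exact: indep2_comp.
have [ccI ccE] := key _ _ mc mc (integrable_cos s mU) (integrable_cos s mV).
have [ssI ssE] := key _ _ ms ms (integrable_sin s mU) (integrable_sin s mV).
have [csI csE] := key _ _ mc ms (integrable_cos s mU) (integrable_sin s mV).
have [scI scE] := key _ _ ms mc (integrable_sin s mU) (integrable_cos s mV).
rewrite /sqnorm_charfun.
under eq_Rintegral do rewrite mulrDr cosD.
under [X in _ + X ^+ 2]eq_Rintegral do rewrite mulrDr sinD.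
rewrite RintegralB// RintegralD// ccE ssE csE scE; ring.
Qed.

Hypothesis Xindep : independent_RVs X.
Hypothesis Xid : identically_distributed X.

Lemma sqnorm_charfun_walk a m s : sqnorm_charfun (walk X a m) s =
  sqnorm_charfun (fun w => X 0%N w - mean X) s ^+ m.
Proof.
elim: m => [|m IH].
  rewrite expr0 /sqnorm_charfun.
  under eq_Rintegral do rewrite walk0 mulr0 cos0.
  under [X in _ + X ^+ 2]eq_Rintegral do rewrite walk0 mulr0 sin0.
  by rewrite !Rintegral_prob_cst expr1n expr0n addr0.
have -> : walk X a m.+1 =
    (fun w => walk X a m w + (X (a + m)%N w - mean X)).
  by apply/funext => w; rewrite walkS.
rewrite sqnorm_charfunD; last 3 first.
- exact: measurable_walk.
- exact: measurable_centered.
- exact: walk_indep.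
rewrite IH exprSr; congr (_ * _); rewrite /sqnorm_charfun.
set mu := mean X.
have mB : measurable_fun setT (fun x : R => x - mu) by exact: measurable_funB.
have [|_ ->] := @id_integral _ _ _ _ _ Xid (a + m)%N 0 (fun x => cos (s * (x - mu))) _
  (integrable_cos s (measurable_centered X _)).
  apply: (measurableT_comp (continuous_measurable_fun (@continuous_cos R))); exact: measurable_funM.
have [|_ ->//] := @id_integral _ _ _ _ _ Xid (a + m)%N 0 (fun x => sin (s * (x - mu))) _
  (integrable_sin s (measurable_centered X _)).
by apply: (measurableT_comp (continuous_measurable_fun (@continuous_sin R))); exact: measurable_funM.
Qed.
End characteristic_function.

(** * Quadratic decay of the characteristic function near 0 *)

Section charfun_decay.
Context (d : measure_display) (T : measurableType d) (R : realType).
Context (P : probability T R) (Y : T -> R).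
Hypothesis mY : measurable_fun setT Y.

Lemma measurable_annulus (N : R) : measurable [set w | N^-1 <= `|Y w| <= N].
Proof.
have mnY : measurable_fun setT (fun w => `|Y w|) by exact: measurableT_comp.
rewrite -[X in measurable X]setTI.
have := mnY measurableT `[N^-1, N]%classic (measurable_itv _).
by congr measurable; apply/seteqP; split=> w /=; rewrite in_itv.
Qed.

(** The annuli with [N = n + 1] exhaust the set where [Y] is nonzero; if all were null, [Y] would
    vanish almost surely and so would its second moment. *)
Lemma annulus_pos : P.-integrable setT (EFin \o (fun w => Y w ^+ 2)) ->
  0 < \int[P]_w (Y w ^+ 2) ->
  exists2 N : R, 1 <= N & 0 < fine (P [set w | N^-1 <= `|Y w| <= N]).
Proof.
move=> iY2 Y2pos; apply: contrapT => hN.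
have A0 (n : nat) : P [set w | n.+1%:R^-1 <= `|Y w| <= n.+1%:R] = 0%E.
  have fP : P [set w | n.+1%:R^-1 <= `|Y w| <= n.+1%:R] \is a fin_num.
    by apply: fin_num_measure; exact: measurable_annulus.
  rewrite -(fineK fP); congr EFin; apply/eqP; rewrite eq_le fine_ge0// andbT.
  rewrite leNgt; apply/negP => h; apply: hN; exists n.+1%:R => //.
  by rewrite ler1n.
suff : \int[P]_w (Y w ^+ 2) = 0 by move=> h; move: Y2pos; rewrite h ltxx.
rewrite /Rintegral (ae_eq_integral (cst 0%E))//=.
- by rewrite integral0.
- exact: measurable_int iY2.
have : P.-negligible (\bigcup_n [set w | n.+1%:R^-1 <= `|Y w| <= n.+1%:R]).
  apply: negligible_bigcup => n; apply/negligibleP; last exact: A0.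
  exact: measurable_annulus.
move=> /(negligibleS _); apply => w /= hw; apply: contrapT => hw'; apply: hw => _.
congr EFin; apply/eqP; rewrite sqrf_eq0; apply/negPn/negP => Yw0.
apply: hw'; have y0 : 0 < `|Y w| by rewrite normr_gt0.
pose n := (Num.truncn `|Y w| + Num.truncn `|Y w|^-1)%N.
exists n => //=; apply/andP; split.
  rewrite -[leRHS]invrK lef_pV2 ?posrE ?invr_gt0//.
  rewrite (le_trans (ltW (truncnS_gt _)))// ler_nat ltnS /n leq_addl//.
rewrite (le_trans (ltW (truncnS_gt _)))// ler_nat ltnS /n leq_addr//.
Qed.

Hypothesis iY : P.-integrable setT (EFin \o Y).
Hypothesis iY2 : P.-integrable setT (EFin \o (fun w => Y w ^+ 2)).
Hypothesis Y0 : \int[P]_w Y w = 0.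

Lemma int_oneBcos s :
  P.-integrable setT (EFin \o (fun w => 1 - cos (s * Y w))) /\
  \int[P]_w (1 - cos (s * Y w)) = 1 - \int[P]_w cos (s * Y w).
Proof.
have i1 := integrable_real_cst P 1; have ic := integrable_cos P s mY.
by split; [exact: integrable_realB|rewrite RintegralB// Rintegral_prob_cst].
Qed.

(** A crude bound from [1 - cos x <= |x|]; it serves to make the cosine integral nonnegative for
    small [s], so that its upper bound can be squared. *)
Lemma int_cos_ge s : 0 <= s ->
  1 - s * (1 + \int[P]_w (Y w ^+ 2)) <= \int[P]_w cos (s * Y w).
Proof.
move=> s0; have [ic Ec] := int_oneBcos s.
have iB := integrable_realD (integrable_real_cst P 1) iY2.
rewrite lerBlDr -lerBlDl -Ec.
have -> : s * (1 + \int[P]_w (Y w ^+ 2)) = \int[P]_w (s * (1 + Y w ^+ 2)).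
  by rewrite RintegralZl// RintegralD// ?Rintegral_prob_cst//; exact: integrable_real_cst.
apply: le_Rintegral => //; first exact: integrable_realZ.
move=> w _; rewrite (le_trans (oneBcos_le _))// normrM ger0_norm// ler_wpM2l//.
rewrite -(real_normK (num_real (Y w))); have := normr_ge0 (Y w); move: `|Y w| => y.
by nra.
Qed.

(** On the annulus [|s Y| <= 1] and [|Y| >= 1 / N], so [1 - cos (s Y)] is at least
    [s ^ 2 / (8 N ^ 2)]; elsewhere it is nonnegative. *)
Lemma int_cos_le (N s : R) : 1 <= N -> 0 <= s -> s * N <= 1 ->
  \int[P]_w cos (s * Y w) <=
  1 - s ^+ 2 * (fine (P [set w | N^-1 <= `|Y w| <= N]) / (8 * N ^+ 2)).
Proof.
move=> N1 s0 sN; have [ic Ec] := int_oneBcos s.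
have N0 : 0 < N by exact: lt_le_trans N1.
rewrite lerBrDr -lerBrDl -Ec -(Rintegral_indic P (measurable_annulus N)).
set A := [set w | _].
have iA : P.-integrable setT (EFin \o (\1_A : T -> R)).
  by apply: integrable_indic; exact: measurable_annulus.
have -> : s ^+ 2 * (\int[P]_w \1_A w / (8 * N ^+ 2)) =
    \int[P]_w (s ^+ 2 / (8 * N ^+ 2) * \1_A w).
  by rewrite RintegralZl//; ring.
apply: le_Rintegral => //; first exact: integrable_realZ.
move=> w _; rewrite indicE; case: (boolP (w \in A)) => [|_]; last first.
  by rewrite mulr0 oneBcos_ge0.
rewrite inE /A/= => /andP[Yl Yu]; rewrite mulr1.
apply: (le_trans _ (oneBcos_ge _)); last first.
  by rewrite normrM (ger0_norm s0) (le_trans _ sN)// ler_wpM2l.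
have -> : s ^+ 2 / (8 * N ^+ 2) = s ^+ 2 * N^-1 ^+ 2 / 8.
  by field; rewrite gt_eqF.
rewrite exprMn ler_wpM2r// ler_wpM2l ?sqr_ge0//.
rewrite -(real_normK (num_real (Y w))) ler_pXn2r// ?nnegrE// invr_ge0 ltW//.
Qed.

Lemma int_sin_le s : `|\int[P]_w sin (s * Y w)| <= s ^+ 2 * \int[P]_w (Y w ^+ 2).
Proof.
have is_ := integrable_sin P s mY.
have isY := integrable_realZ s iY.
have iB := integrable_realB is_ isY.
(* Since [Y] has mean 0, the linear term can be subtracted for free. *)
have -> : \int[P]_w sin (s * Y w) = \int[P]_w (sin (s * Y w) - s * Y w).
  by rewrite RintegralB// RintegralZl// Y0 mulr0 subr0.
rewrite (le_trans (le_normr_Rintegral measurableT iB))// -RintegralZl//.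
apply: le_Rintegral => //.
- exact: integrable_norm.
- exact: integrable_realZ.
- by move=> w _; rewrite -exprMn; exact: normr_sinB_le.
Qed.

Lemma sqnorm_charfun_le : 0 < \int[P]_w (Y w ^+ 2) ->
  exists s0 k : R, [/\ 0 < s0, 0 < k &
    forall s, 0 < s <= s0 -> sqnorm_charfun P Y s <= 1 - k * s ^+ 2].
Proof.
move=> v0; have [N N1 pN] := annulus_pos iY2 v0.
have N0 : 0 < N by exact: lt_le_trans N1.
set v := \int[P]_w _ in v0; set p := fine _ in pN.
pose e := p / (8 * N ^+ 2).
have e0 : 0 < e by rewrite divr_gt0// mulr_gt0// exprn_gt0.
have b1 : 0 < N^-1 by rewrite invr_gt0.
have b2 : 0 < (1 + v)^-1 by rewrite invr_gt0; lra.
have b3 : 0 < e / (2 * (v ^+ 2 + 1)) by rewrite divr_gt0//; have := sqr_ge0 v; lra.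
(* The three bounds on [s] respectively validate [int_cos_le], make the cosine integral nonnegative,
   and let the squared sine part use up only half of the gain [s ^ 2 * e]. *)
exists (Num.min N^-1 (Num.min (1 + v)^-1 (e / (2 * (v ^+ 2 + 1))))), (e / 2).
split.
- by rewrite !lt_min b1 b2.
- by rewrite divr_gt0.
move=> s /andP[s0]; rewrite !le_min => /and3P[sN sv se].
have {}sN : s * N <= 1 by rewrite -ler_pdivlMr// div1r.
have {}sv : s * (1 + v) <= 1 by rewrite -ler_pdivlMr ?div1r//; lra.
have {}se : s * (2 * (v ^+ 2 + 1)) <= e.
  by rewrite -ler_pdivlMr//; have := sqr_ge0 v; lra.
have c0 := int_cos_ge (ltW s0); have c1 := int_cos_le N1 (ltW s0) sN.
have sn := int_sin_le s.
rewrite /sqnorm_charfun; move: c0 c1 sn; rewrite -/v -/p -/e.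
set c := \int[P]_w cos _; set z := \int[P]_w sin _ => c0 c1 sn.
have {}c0 : 0 <= c by lra.
have c2 : c ^+ 2 <= 1 - s ^+ 2 * e.
  by have := mulr_ge0 (sqr_ge0 s) (ltW e0); nra.
have z2 : z ^+ 2 <= (s ^+ 2 * v) ^+ 2.
  by rewrite -(real_normK (num_real z)) ler_pXn2r ?nnegrE// mulr_ge0 ?sqr_ge0// ltW.
have s1 : s <= 1 by nra.
have sv2 : s ^+ 2 * v ^+ 2 <= e / 2.
  have h : s ^+ 2 * v ^+ 2 <= s * (v ^+ 2 + 1).
    by have := sqr_ge0 v; nra.
  by lra.
have : (s ^+ 2 * v) ^+ 2 <= s ^+ 2 * (e / 2).
  have -> : (s ^+ 2 * v) ^+ 2 = s ^+ 2 * (s ^+ 2 * v ^+ 2) by ring.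
  by rewrite ler_wpM2l// sqr_ge0.
by lra.
Qed.
End charfun_decay.

(** * Lower bounds for the upper tail of the walk *)

Section walk_tail.
Context (d : measure_display) (T : measurableType d) (R : realType).
Context (P : probability T R) (X : nat -> {RV P >-> R}).
Hypothesis Xindep : independent_RVs X.
Hypothesis Xid : identically_distributed X.
Hypothesis X2fin : ('E_P[(fun w => X 0%N w ^+ 2)%R] < +oo)%E.
Hypothesis Vpos : (0 < 'V_P[X 0%N])%E.

Lemma measurable_walk_ge a m (x : R) : measurable [set w | x <= walk X a m w].
Proof.
rewrite -[X in measurable X]setTI.
have := measurable_walk X a m measurableT (measurable_itv `[x, +oo[).
by congr measurable; apply/seteqP; split=> w /=; rewrite in_itv/= andbT.
Qed.

Lemma exists_walk_charfun : exists2 A : R, 0 < A & exists n0 : nat,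
  forall a n, (n0 <= n)%N -> (0 < n)%N ->
  \int[P]_w cos (A / n%:R * walk X a (n ^ 2) w) <= 2^-1.
Proof.
have [Yi YE] := centered_mean0 Xid X2fin 0.
have [Y2i Y2E] := centered_var Xid X2fin 0.
have v0 := var_gt0 X2fin Vpos; rewrite -Y2E in v0.
have [s0 [k [s0pos k0 hk]]] :=
  sqnorm_charfun_le (measurable_centered X 0) Yi Y2i YE v0.
(* Then [A >= 1] and [A * k >= 3], so [n ^ 2 * (k * s ^ 2) >= 3] for [s = A / n], and [expr_oneB_le]
   bounds the squared modulus by [1 / (1 + 3)]. *)
exists (3 / k + 1); first by rewrite addr_gt0// divr_gt0.
set A := 3 / k + 1.
have A1 : 1 <= A by rewrite /A lerDr ltW// divr_gt0.
have Ak : 3 <= A * k by rewrite /A mulrDl divfK ?gt_eqF// mul1r lerDl ltW.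
exists (Num.truncn (A / s0)).+1 => a n n0n n0.
have nR : 0 < n%:R :> R by rewrite ltr0n.
have A0 : 0 < A by lra.
have sp : 0 < A / n%:R by rewrite divr_gt0.
have ss : A / n%:R <= s0.
  rewrite ler_pdivrMr// mulrC -ler_pdivrMr// (le_trans (ltW (truncnS_gt _)))//.
  by rewrite ler_nat.
have := hk (A / n%:R); rewrite sp ss => /(_ isT); set s := A / n%:R.
have := sqnorm_charfun_walk Xindep Xid a (n ^ 2) s.
set rho := sqnorm_charfun P (fun w => X 0%N w - mean X) s => E hrho.
have rho0 : 0 <= rho by rewrite /rho /sqnorm_charfun addr_ge0 ?sqr_ge0.
have x01 : 0 <= k * s ^+ 2 <= 1.
  have -> : 0 <= k * s ^+ 2 by apply: mulr_ge0; [exact: ltW|exact: sqr_ge0].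
  by move: hrho rho0 => /=; lra.
have mx : 3 <= (n ^ 2)%:R * (k * s ^+ 2).
  have -> : (n ^ 2)%:R * (k * s ^+ 2) = A * (A * k).
    by rewrite natrX /s; field; rewrite gt_eqF.
  by nra.
have q : rho ^+ (n ^ 2) <= 2^-1 ^+ 2.
  apply: (@le_trans _ _ ((1 - k * s ^+ 2) ^+ (n ^ 2))).
    by rewrite lerXn2r ?nnegrE//; lra.
  have := expr_oneB_le (n ^ 2) x01.
  have : 0 <= (1 - k * s ^+ 2) ^+ (n ^ 2) by rewrite exprn_ge0//; lra.
  by nra.
move: q; rewrite -E /sqnorm_charfun; set c := \int[P]_w _; set z := \int[P]_w _.
by have := sqr_ge0 z; nra.
Qed.

Lemma walk_tail : exists eps c : R, [/\ 0 < eps, 0 < c &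
  exists n0 : nat, forall a n, (n0 <= n)%N ->
  c <= fine (P [set w | eps * n%:R <= walk X a (n ^ 2) w])].
Proof.
have [A A0 [n0 hA]] := exists_walk_charfun.
have v0 := var_gt0 X2fin Vpos.
(* Chosen so that, after integrating [key] below, the [eps] term equals [1/8] and the second-moment
   term is at most [1/8]. Against the lower bound [1/2] this leaves [1/4 <= A / del * P B], whence
   the constant [del / (4 * A)]. *)
pose del := (8 * A * (var X + 1))^-1; pose eps := (16 * A)^-1.
have del0 : 0 < del by rewrite invr_gt0 !mulr_gt0//; lra.
have eps0 : 0 < eps by rewrite invr_gt0 mulr_gt0.
exists eps, (del / (4 * A)); split => //; first by rewrite divr_gt0// mulr_gt0.
exists n0.+1 => a n n0n; have n_gt0 : (0 < n)%N by exact: leq_trans n0n.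
have nR : 0 < n%:R :> R by rewrite ltr0n.
have := hA a n (ltnW n0n) n_gt0; set s := A / n%:R.
have s0 : 0 < s by rewrite divr_gt0.
set B := [set w | _]; have mB : measurable B by exact: measurable_walk_ge.
have mW := measurable_walk X a (n ^ 2).
have [Wi WE] := walk_mean0 Xid X2fin a (n ^ 2).
have [W2i W2E] := walk_var Xindep Xid X2fin a (n ^ 2).
have [ic Ec] := int_oneBcos P mW s.
pose W := walk X a (n ^ 2).
have i1 : P.-integrable setT (EFin \o (\1_B : T -> R)) by exact: integrable_indic.
have i2 := integrable_realZ (del / n%:R) W2i.
have i3 := integrable_realZ (n%:R / del) i1.
have i4 := integrable_realD i2 i3.
have i5 := integrable_realD (integrable_real_cst P (2 * eps * n%:R)) i4.
have i6 := integrable_realB i5 Wi.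
have i7 := integrable_realZ s i6.
(* [|x| = 2 x^+ - x], where [x^+ <= eps n] off [B] and, by AM-GM,
   [2 x <= (del / n) x ^ 2 + n / del] on [B]. *)
have key w : 1 - cos (s * W w) <= s * ((2 * eps * n%:R +
    (del / n%:R * W w ^+ 2 + n%:R / del * \1_B w)) - W w).
  rewrite (le_trans (oneBcos_le _))// normrM gtr0_norm// ler_pM2l//.
  have d1 : 0 < del / n%:R by rewrite divr_gt0.
  have d2 : 0 < n%:R / del by rewrite divr_gt0.
  have dd : (del / n%:R) * (n%:R / del) = 1 by field; rewrite !gt_eqF.
  have h1 : 0 <= del / n%:R * W w ^+ 2 by rewrite mulr_ge0 ?sqr_ge0// ltW.
  have en : 0 < eps * n%:R by rewrite mulr_gt0.
  rewrite indicE; case: (boolP (w \in B)) => [|].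
    rewrite inE /B/= -/(W w) => hB.
    rewrite ger0_norm ?mulr1; last by lra.
    move: (del / n%:R) (n%:R / del) d1 d2 dd h1 => x y x0 y0 xy _.
    have : 0 <= x * (W w - y) ^+ 2 by rewrite mulr_ge0 ?sqr_ge0// ltW.
    have -> : x * (W w - y) ^+ 2 = x * W w ^+ 2 - 2 * (x * y) * W w + (x * y) * y.
      by ring.
    by rewrite xy; lra.
  rewrite notin_setE /B/= -/(W w) => /negP; rewrite -ltNge => hB.
  rewrite mulr0 addr0; have [W0|W0] := leP 0 (W w).
    by rewrite ger0_norm//; lra.
  by rewrite ltr0_norm//; lra.
have := @le_Rintegral _ _ _ P setT _ _ measurableT ic i7 (fun w _ => key w).
rewrite Ec RintegralZl// RintegralB// RintegralD//; last exact: integrable_real_cst.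
rewrite Rintegral_prob_cst RintegralD// !RintegralZl// WE W2E Rintegral_indic//.
set p := fine _ => h1 h2.
have : 2^-1 <= 8^-1 + 8^-1 + A / del * p.
  have e1 : s * (2 * eps * n%:R) = 8^-1.
    by rewrite /s /eps; field; rewrite !gt_eqF.
  have e2 : s * (del / n%:R * ((n ^ 2)%:R * var X)) <= 8^-1.
    have -> : s * (del / n%:R * ((n ^ 2)%:R * var X)) = 8^-1 * (var X / (var X + 1)).
      rewrite /s /del natrX; field; rewrite !gt_eqF//; lra.
    by rewrite ler_piMr// ler_pdivrMr; lra.
  have e3 : s * (n%:R / del * p) = A / del * p.
    by rewrite /s; field; rewrite !gt_eqF.
  by rewrite -e3; lra.
move=> h3; have : 4^-1 <= A / del * p by lra.
rewrite -[A / del]invf_div mulrC ler_pdivlMr ?divr_gt0// => h4.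
by rewrite (le_trans _ h4)// invfM; lra.
Qed.

(** The past event [A] is arbitrary, since it will be an intersection of events about several
    earlier blocks. *)
Lemma walk_event_indep b m (A : set T) (B : set R) :
  <<s cylinder X [set i | i < b]%N >> A -> measurable B ->
  P (A `&` walk X b m @^-1` B) = (P A * P (walk X b m @^-1` B))%E.
Proof.
move=> hA mB.
apply: (sigma_indep Xindep (I := [set i | i < b]%N) (J := [set i | b <= i]%N)) => //.
- by apply/seteqP; split => // i /= [] /leq_trans h /h; rewrite ltnn.
- by apply: sigma_sum => // i _ /=; rewrite leq_addr.
Qed.

(** If each of [r] consecutive blocks of length [n ^ 2] rises by [eps * n], the rises add up, and
    the blocks are independent. *)
Lemma walk_blocks (eps c : R) (n : nat) : 0 <= c ->
  (forall a, c <= fine (P [set w | eps * n%:R <= walk X a (n ^ 2) w])) ->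
  forall r a, c ^+ r <=
    fine (P [set w | r%:R * (eps * n%:R) <= walk X a (r * n ^ 2) w]).
Proof.
move=> c0 h; elim=> [|r IH] a.
  rewrite (_ : [set w | _] = setT) ?probability_setT//.
  by apply/seteqP; split => // w _ /=; rewrite mul0n walk0 mul0r.
set b := (a + r * n ^ 2)%N; set x := eps * n%:R.
set C := [set w | r%:R * x <= walk X a (r * n ^ 2) w].
set D := [set w | x <= walk X b (n ^ 2) w].
have mC : measurable C by exact: measurable_walk_ge.
have mD : measurable D by exact: measurable_walk_ge.
have CD : P (C `&` D) = (P C * P D)%E.
  have DE : D = walk X b (n ^ 2) @^-1` `[x, +oo[%classic.
    by apply/seteqP; split=> w /=; rewrite in_itv/= andbT.
  have CE : C = walk X a (r * n ^ 2) @^-1` `[r%:R * x, +oo[%classic.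
    by apply/seteqP; split=> w /=; rewrite in_itv/= andbT.
  rewrite DE walk_event_indep// CE; apply: sigma_sum => // i ir /=.
  by rewrite ltn_add2l.
apply: (@le_trans _ _ (fine (P (C `&` D)))).
  rewrite CD fineM ?fin_num_measure// exprSr ler_pM ?exprn_ge0//.
  - exact: IH.
  - exact: h.
have mE := measurable_walk_ge a (r.+1 * n ^ 2) (r.+1%:R * x).
apply: fine_le.
- by apply: fin_num_measure; exact: measurableI.
- exact: fin_num_measure.
apply: le_measure; rewrite ?inE//; first exact: measurableI.
move=> w [/= Cw Dw].
by rewrite mulSn addnC walkD -natr1 mulrDl mul1r lerD.
Qed.
End walk_tail.

(** * The rate event for exponent 2 is null *)

Section quadratic_rate.
Context (d : measure_display) (T : measurableType d) (R : realType).
Context (P : probability T R) (X : nat -> {RV P >-> R}).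

Definition quadratic_rate (M : nat) : set T := [set w | forall n k : nat,
  (M <= n)%N -> (0 < k)%N -> (n ^ 2 <= k)%N ->
  `| k%:R^-1 * (\sum_(i < k) X i w) - fine 'E_P[X 0%N] | < n%:R^-1].

Lemma measurable_quadratic_rate M : measurable (quadratic_rate M).
Proof.
rewrite (_ : quadratic_rate M = \bigcap_n \bigcap_k [set w |
    (M <= n)%N -> (0 < k)%N -> (n ^ 2 <= k)%N ->
  `| k%:R^-1 * (\sum_(i < k) X i w) - fine 'E_P[X 0%N] | < n%:R^-1]); last first.
  by apply/seteqP; split => w h n; [move=> _ k _; exact: h|move=> k; exact: h].
apply: bigcapT_measurable => n; apply: bigcapT_measurable => k.
have [nk|nk] := boolP [&& (M <= n)%N, (0 < k)%N & (n ^ 2 <= k)%N]; last first.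
  rewrite (_ : [set _ | _] = setT)//; apply/seteqP; split => // w _ /= h1 h2 h3.
  by move: nk; rewrite h1 h2 h3.
move/and3P: nk => [Mn k0 nk].
have mf : measurable_fun setT (fun w =>
    `| k%:R^-1 * (\sum_(i < k) X i w) - fine 'E_P[X 0%N] |).
  apply: measurableT_comp => //; apply: measurable_funB => //.
  by apply: measurable_funM => //; exact: measurable_sum.
rewrite -[X in measurable X]setTI.
have := mf measurableT _ (measurable_itv `]-oo, n%:R^-1[).
congr measurable; apply/seteqP; split => w /=; rewrite in_itv/=.
  by move=> [_ h]; split.
by move=> [_ h]; split => //; exact: h.
Qed.

(** At [t = 2] the property would yield [2 < 2]. Conversely, if [t <= 2] then [n ^ t <= n ^ 2] for
    [n >= 1], so a rate with exponent [t] gives one with exponent 2. *)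
Lemma rate_exponent_gt2P w :
  rate_exponent_gt2 X w <-> ~ (\bigcup_M quadratic_rate M.+1) w.
Proof.
split=> [hw [M _ hM]|hw t t0 [M [M0 hM]]].
  have := hw 2 _ _; rewrite ltxx => h; apply/notF/h => //.
  exists M.+1; split=> // n k Mn k0; rewrite (powR_mulrn 2)// -natrX ler_nat.
  exact: hM.
rewrite ltNge; apply/negP => t2; apply: hw; exists M.-1 => //.
rewrite prednK// => n k Mn k0 nk; apply: hM => //.
have n1 : (0 < n)%N by exact: leq_trans Mn.
apply: (@le_trans _ _ (n%:R `^ 2)); first by rewrite ler_powR// ler1n.
by rewrite (powR_mulrn 2)// -natrX ler_nat.
Qed.

(** Take [k = n ^ 2] and multiply the deviation of the average by [n ^ 2]. *)
Lemma walk_lt_of_quadratic_rate M n w : (0 < M)%N -> (M <= n)%N ->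
  quadratic_rate M w -> `|walk X 0 (n ^ 2) w| < n%:R.
Proof.
move=> M0 Mn hw; have n0 : (0 < n)%N by exact: leq_trans Mn.
have nR : 0 < n%:R :> R by rewrite ltr0n.
have := hw n (n ^ 2)%N Mn _ (leqnn _); rewrite expn_gt0 n0 => /(_ isT).
have n2 : (n ^ 2)%:R != 0 :> R by rewrite natrX expf_neq0// gt_eqF.
have -> : walk X 0 (n ^ 2) w =
    (n ^ 2)%:R * ((n ^ 2)%:R^-1 * (\sum_(i < n ^ 2) X i w) - fine 'E_P[X 0%N]).
  by rewrite mulrBr mulVKf// /walk sumrB sumr_const card_ord mulr_natl.
rewrite normrM ger0_norm// -ltr_pdivlMl ?ltr0n ?expn_gt0 ?n0// natrX.
by rewrite expr2 invfM mulfVK// gt_eqF.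
Qed.

Hypothesis Xindep : independent_RVs X.
Hypothesis Xid : identically_distributed X.
Hypothesis X2fin : ('E_P[(fun w => X 0%N w ^+ 2)%R] < +oo)%E.
Hypothesis Vpos : (0 < 'V_P[X 0%N])%E.

(* Between consecutive squares [q ^ j] the walk cannot move by [(q + 1) q ^ j]
   on the event [quadratic_rate M], whereas each such move has probability at
   least [c] independently of the past. *)
Lemma prob_quadratic_rate_le M : (0 < M)%N -> exists2 c : R, 0 < c <= 1 &
  forall J, fine (P (quadratic_rate M)) <= (1 - c) ^+ J.
Proof.
move=> M0; have [eps [c [eps0 c0 [n0 hc]]]] := walk_tail Xindep Xid X2fin Vpos.
(* [q - 1] exceeds [1 / eps], and [r = (q - 1) * (q + 1)]; hence [r * eps * n >= (q + 1) * n].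
   Moreover [r] blocks of length [n ^ 2] lead from time [n ^ 2] to [(q * n) ^ 2]. *)
pose q := (Num.truncn eps^-1).+2; pose r := (q ^ 2).-1.
have q1 : (1 < q)%N by [].
have qr : (r.+1 = q ^ 2)%N by rewrite prednK// expn_gt0.
have qeps : 1 <= (q%:R - 1) * eps.
  rewrite -ler_pdivrMr// div1r -natr1 addrK.
  exact/ltW/truncnS_gt.
have rE : r%:R = (q%:R - 1) * (q%:R + 1) :> R.
  have : r.+1%:R = q%:R ^+ 2 :> R by rewrite qr natrX.
  by rewrite -natr1 => h; rewrite -[LHS](addrK 1) h; ring.
(* The offset in the exponent puts every [N j] above both thresholds, as [q ^ m > m]. *)
pose N j := (q ^ (maxn M n0 + j))%N.
have NS j : N j.+1 = (q * N j)%N by rewrite /N addnS expnS.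
have leN j : (maxn M n0 <= N j)%N.
  by rewrite (leq_trans (leq_addr j _))// ltnW// ltn_expl.
have Nadd j : (N j ^ 2 + r * N j ^ 2 = N j.+1 ^ 2)%N.
  by rewrite -mulSn qr NS expnMn.
pose B j := `]-oo, ((q%:R + 1) * (N j)%:R : R)[%classic.
pose G j := walk X (N j ^ 2) (r * N j ^ 2) @^-1` B j.
have mG j : measurable (G j).
  by rewrite -[G j]setTI; apply: measurable_walk => //; exact: measurable_itv.
have PG j : fine (P (G j)) <= 1 - c ^+ r.
  have n0N : (n0 <= N j)%N by rewrite (leq_trans _ (leN j))// leq_maxr.
  have := walk_blocks Xindep (ltW c0) (fun a => hc a _ n0N) r (N j ^ 2).
  set D := [set w | _]; have mD : measurable D by exact: measurable_walk_ge.
  have -> : fine (P D) = 1 - fine (P (~` D)).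
    rewrite probability_setC// fineB ?fin_num_measure//=; ring.
  move=> h; apply: (@le_trans _ _ (fine (P (~` D)))); last by lra.
  apply: fine_le; try (by apply: fin_num_measure => //; exact: measurableC).
  apply: le_measure; rewrite ?inE//; first exact: measurableC.
  move=> w; rewrite /G /B /D/= in_itv/= => hw; apply/negP; rewrite -ltNge.
  apply: (lt_le_trans hw); rewrite rE mulrA ler_wpM2r//.
  by have : 0 <= q%:R :> R by []; nra.
exists (c ^+ r).
  rewrite exprn_gt0//=; have := PG 0%N.
  have := fine_ge0 (measure_ge0 P (G 0%N)); lra.
have c1 : 0 <= 1 - c ^+ r.
  by have := PG 0%N; have := fine_ge0 (measure_ge0 P (G 0%N)); lra.
pose H J := \bigcap_(j in `I_J) G j.
have sigmaH J : <<s cylinder X [set i | i < N J ^ 2]%N >> (H J).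
  apply: (@fin_bigcap_measurable _
    (g_sigma_algebraType (cylinder X [set i | i < N J ^ 2]%N))) => // j jJ.
  apply: sigma_sum; last exact: measurable_itv.
  (* Block [j < J] ends at time [N j.+1 ^ 2], which is at most [N J ^ 2]. *)
  move=> i ir /=; apply: (@leq_trans (N j.+1 ^ 2)).
    by rewrite -Nadd ltn_add2l.
  by rewrite leq_exp2r// leq_exp2l// leq_add2l.
have PH J : fine (P (H J)) <= (1 - c ^+ r) ^+ J.
  elim: J => [|J IH].
    by rewrite /H II0 bigcap_set0 probability_setT.
  have mH : measurable (H J) by exact: sigma_cylinder_measurable (sigmaH J).
  have -> : H J.+1 = H J `&` G J by rewrite /H IIS bigcap_setU bigcap_set1.
  rewrite (walk_event_indep Xindep _ (sigmaH J) (measurable_itv _)).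
  rewrite fineM ?fin_num_measure//; last exact: mG.
  by rewrite exprSr ler_pM// ?fine_ge0//; exact: PG.
move=> J; apply: le_trans (PH J).
have mH : measurable (H J) by exact: sigma_cylinder_measurable (sigmaH J).
have mQ := measurable_quadratic_rate M.
apply: fine_le; try exact: fin_num_measure.
apply: le_measure; rewrite ?inE// => w hw j _.
have MN i : (M <= N i)%N by rewrite (leq_trans _ (leN i))// leq_maxl.
have h1 := walk_lt_of_quadratic_rate M0 (MN j) hw.
have h2 := walk_lt_of_quadratic_rate M0 (MN j.+1) hw.
(* The increment is below [N j.+1 + N j = (q + 1) * N j], by the bounds at its two ends. *)
rewrite /G /B/= in_itv/=; move: h2; rewrite -Nadd walkD add0n NS natrM.
by move: h1; rewrite !ltr_norml => /andP[h1 _] /andP[_ h2]; lra.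
Qed.

Lemma prob_quadratic_rate M : (0 < M)%N -> P (quadratic_rate M) = 0%E.
Proof.
move=> M0; have [c c01 h] := prob_quadratic_rate_le M0.
have mQ := measurable_quadratic_rate M.
have p0 : 0 <= fine (P (quadratic_rate M)) by exact: fine_ge0.
suff : fine (P (quadratic_rate M)) = 0.
  by move=> E; rewrite -[LHS]fineK ?fin_num_measure// E.
apply/eqP; rewrite eq_le p0 andbT leNgt; apply/negP.
set p := fine _ in h p0 *; move=> pp.
have /andP[c0 c1] := c01.
have c01' : 0 <= c <= 1 by rewrite ltW.
(* With [J * p * c > 1] this contradicts [p * (1 + J * c) <= 1], which follows from
   [p <= (1 - c) ^ J] and [expr_oneB_le]. *)
pose J := (Num.truncn (p * c)^-1).+1.
have hJ : (p * c)^-1 < J%:R by exact: truncnS_gt.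
have : 1 < J%:R * (p * c) by rewrite -ltr_pdivrMr ?mulr_gt0// div1r.
have := expr_oneB_le J c01'.
have Jc : 0 <= J%:R * c by rewrite mulr_ge0// ltW.
have := ler_wpM2r (addr_ge0 ler01 Jc) (h J).
by move=> h1 h2 h3; nra.
Qed.
End quadratic_rate.

Unset Implicit Arguments.

Theorem theorem28 (d : measure_display) (T : measurableType d) (R : realType)
    (P : probability T R) (X : nat -> {RV P >-> R})
    (Xindep : independent_RVs X) (Xid : identically_distributed X)
    (X2fin : ('E_P[(fun w => X 0%N w ^+ 2)%R] < +oo)%E)
    (Vpos : (0 < 'V_P[X 0%N])%E) :
  measurable [set w | rate_exponent_gt2 X w] /\
  P [set w | rate_exponent_gt2 X w] = 1%E.
Proof.
(* The uncountable quantification over [t] disappears here: what remains is the complement of a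
   countable union of measurable null sets. *)
have -> : [set w | rate_exponent_gt2 X w] = ~` (\bigcup_M quadratic_rate X M.+1).
  by apply/seteqP; split => w /= /rate_exponent_gt2P.
have mU : measurable (\bigcup_M quadratic_rate X M.+1).
  by apply: bigcupT_measurable => M; exact: measurable_quadratic_rate.
split; first exact: measurableC.
rewrite probability_setC//.
have /negligibleP -> // : P.-negligible (\bigcup_M quadratic_rate X M.+1).
  apply: negligible_bigcup => M; apply/negligibleP.
    exact: measurable_quadratic_rate.
  exact: prob_quadratic_rate.
by rewrite sube0.
Qed.
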